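(* Let $\mathcal{A}$ be an Abelian category and $\mathcal{T}\subseteq\mathcal{A}$ a subcategory. Consider the following assertions: (1) $\mathcal{T}=V^{\perp_1}$ for some object $V$ that is $\mathrm{Ext}^1$-universal in $\mathcal{A}$ and satisfies that $V^{(I)}\in V^{\perp_1}$, for all sets $I$ for which the coproduct $V^{(I)}$ exists in $\mathcal{A}$; (2) $\mathcal{T}$ is special preenveloping in $\mathcal{A}$ and it is closed under extensions and direct summands; (3) $({}^{\perp_1}\mathcal{T},\mathcal{T})$ is a right complete cotorsion pair in $\mathcal{A}$. The implications (1)$\Rightarrow$(2)$\Leftrightarrow$(3) hold true. When, in addition, $\mathcal{A}$ has an epi-generator and $\mathcal{T}$ is closed under coproducts and quotients (e.g., when $\mathcal{T}$ is a torsion class), all assertions are equivalent.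
   Context: All subcategories are full. Abelian categories are not assumed to have all small (co)products; (co)products appearing in definitions are those that exist. $\mathrm{Ext}^1_{\mathcal{A}}$ is the Yoneda (possibly proper class) group of extensions. $V^{\perp_1}=\{A\in\mathcal{A}:\mathrm{Ext}^1_{\mathcal{A}}(V,A)=0\}$ and ${}^{\perp_1}\mathcal{T}=\{A\in\mathcal{A}:\mathrm{Ext}^1_{\mathcal{A}}(A,T)=0\ \forall T\in\mathcal{T}\}$ (similarly $\mathcal{X}^{\perp_1}$ for a class $\mathcal{X}$). A morphism $\phi\colon M\to T_M$ with $T_M\in\mathcal{T}$ is a $\mathcal{T}$-preenvelope if $\mathcal{A}(T_M,T)\to\mathcal{A}(M,T)$ is surjective for all $T\in\mathcal{T}$; it is a special $\mathcal{T}$-preenvelope if moreover it is a monomorphism and $\mathrm{Coker}(\phi)\in{}^{\perp_1}\mathcal{T}$. $\mathcal{T}$ is special preenveloping if every object of $\mathcal{A}$ has a special $\mathcal{T}$-preenvelope. A cotorsion pair is a pair $(\mathcal{X},\mathcal{Y})$ of subcategories with $\mathcal{Y}=\mathcal{X}^{\perp_1}$ and $\mathcal{X}={}^{\perp_1}\mathcal{Y}$; it is right complete if every $A\in\mathcal{A}$ admits a short exact sequence $0\to A\to Y\to X\to 0$ with $X\in\mathcal{X}$, $Y\in\mathcal{Y}$. A universal extension of $B$ by $A$ is a short exact sequence $0\to A\to X\to B^{(J)}\to 0$, with $J$ a non-empty set for which $B^{(J)}$ exists, such that the connecting morphism $\mathcal{A}(B,B^{(J)})\to\mathrm{Ext}^1_{\mathcal{A}}(B,A)$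 is surjective. $B$ is $\mathrm{Ext}^1$-universal if a universal extension of $B$ by any object of $\mathcal{A}$ exists. An epi-generator of $\mathcal{A}$ is an object $G$ such that every object of $\mathcal{A}$ is a quotient of an existing coproduct of copies of $G$. *)

(* Defs.v *)
From HB Require Import structures.
From mathcomp Require Import all_boot all_order all_algebra.
From mathcomp Require Import boolp classical_sets.

Set Implicit Arguments.
Unset Strict Implicit.
Unset Printing Implicit Defensive.

Import GRing.Theory.
Local Open Scope ring_scope.
Local Open Scope classical_set_scope.

(* The "sets" indexing coproducts. All of them are taken in this one fixed
   universe; the objects of a category may form a larger type. *)
Definition smallType := Type.

(* Categories whose hom-sets are abelian groups, with bilinear composition
   [compm g f] = g after f. *)
Record preadditiveCat := PreadditiveCat {
  obj :> Type;
  Hom : obj -> obj -> zmodType;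
  idm : forall X, Hom X X;
  compm : forall X Y Z, Hom Y Z -> Hom X Y -> Hom X Z;
  compmA : forall W X Y Z (h : Hom Y Z) (g : Hom X Y) (f : Hom W X),
    compm h (compm g f) = compm (compm h g) f;
  comp1m : forall X Y (f : Hom X Y), compm (idm Y) f = f;
  compm1 : forall X Y (f : Hom X Y), compm f (idm X) = f;
  compmDl : forall X Y Z (g g' : Hom Y Z) (f : Hom X Y),
    compm (g + g') f = compm g f + compm g' f;
  compmDr : forall X Y Z (g : Hom Y Z) (f f' : Hom X Y),
    compm g (f + f') = compm g f + compm g f'
}.

Notation "g ∘ f" := (compm g f) (at level 40, left associativity) : ring_scope.

Section Preadditive.
Variable C : preadditiveCat.
Implicit Types A B X Y Z : C.

Definition is_mono X Y (f : Hom X Y) : Prop :=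
  forall W (g h : Hom W X), f ∘ g = f ∘ h -> g = h.

Definition is_epi X Y (f : Hom X Y) : Prop :=
  forall Z (g h : Hom Y Z), g ∘ f = h ∘ f -> g = h.

Definition is_zero_object Z : Prop :=
  forall X, (forall f : Hom X Z, f = 0) /\ (forall f : Hom Z X, f = 0).

Definition is_kernel K X Y (k : Hom K X) (f : Hom X Y) : Prop :=
  f ∘ k = 0 /\
  forall W (g : Hom W X), f ∘ g = 0 -> exists! h : Hom W K, k ∘ h = g.

Definition is_cokernel X Y Q (q : Hom Y Q) (f : Hom X Y) : Prop :=
  q ∘ f = 0 /\
  forall W (g : Hom Y W), g ∘ f = 0 -> exists! h : Hom Q W, h ∘ q = g.

Definition is_biproduct A B S (i1 : Hom A S) (i2 : Hom B S)
    (p1 : Hom S A) (p2 : Hom S B) : Prop :=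
  [/\ p1 ∘ i1 = idm A, p2 ∘ i2 = idm B, p1 ∘ i2 = 0, p2 ∘ i1 = 0
    & i1 ∘ p1 + i2 ∘ p2 = idm S].

Definition is_pullback P X B Y (g : Hom P X) (q : Hom P B)
    (p : Hom X Y) (f : Hom B Y) : Prop :=
  p ∘ g = f ∘ q /\
  forall W (u : Hom W X) (v : Hom W B), p ∘ u = f ∘ v ->
    exists! t : Hom W P, g ∘ t = u /\ q ∘ t = v.

Definition is_coproduct (I : smallType) (F : I -> C) (S : C)
    (inj : forall i, Hom (F i) S) : Prop :=
  forall Y (g : forall i, Hom (F i) Y),
    exists! h : Hom S Y, forall i, h ∘ inj i = g i.

(* [S], with the injections [inj], is the copower B^(I). *)
Definition is_copower (I : smallType) (B S : C) (inj : I -> Hom B S) : Prop :=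
  is_coproduct (F := fun _ : I => B) inj.

Definition is_short_exact A X B (i : Hom A X) (p : Hom X B) : Prop :=
  is_kernel i p /\ is_cokernel p i.

End Preadditive.

Record abelianCat := AbelianCat {
  preadditive_of :> preadditiveCat;
  has_zero_object : exists Z : preadditive_of, is_zero_object Z;
  has_biproducts : forall A B : preadditive_of,
    exists (S : preadditive_of) (i1 : Hom A S) (i2 : Hom B S)
           (p1 : Hom S A) (p2 : Hom S B), is_biproduct i1 i2 p1 p2;
  has_kernels : forall (X Y : preadditive_of) (f : Hom X Y),
    exists (K : preadditive_of) (k : Hom K X), is_kernel k f;
  has_cokernels : forall (X Y : preadditive_of) (f : Hom X Y),
    exists (Q : preadditive_of) (q : Hom Y Q), is_cokernel q f;
  mono_is_kernel : forall (X Y : preadditive_of) (f : Hom X Y), is_mono f ->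
    exists (Z : preadditive_of) (g : Hom Y Z), is_kernel f g;
  epi_is_cokernel : forall (X Y : preadditive_of) (f : Hom X Y), is_epi f ->
    exists (W : preadditive_of) (g : Hom W X), is_cokernel f g
}.

Section PreadditiveFacts.
Variable C : preadditiveCat.
Implicit Types A B X Y Z : C.

Lemma comp0m X Y Z (f : Hom X Y) : (0 : Hom Y Z) ∘ f = 0.
Proof. by apply: (addrI (0 ∘ f)); rewrite -compmDl !addr0. Qed.

Lemma compm0 X Y Z (g : Hom Y Z) : g ∘ (0 : Hom X Y) = 0.
Proof. by apply: (addrI (g ∘ 0)); rewrite -compmDr !addr0. Qed.

Lemma compNm X Y Z (g : Hom Y Z) (f : Hom X Y) : (- g) ∘ f = - (g ∘ f).
Proof. by apply: (addrI (g ∘ f)); rewrite -compmDl !subrr comp0m. Qed.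

Lemma compmN X Y Z (g : Hom Y Z) (f : Hom X Y) : g ∘ (- f) = - (g ∘ f).
Proof. by apply: (addrI (g ∘ f)); rewrite -compmDr !subrr compm0. Qed.

Lemma epiP X Y (f : Hom X Y) :
  (forall Z (u : Hom Y Z), u ∘ f = 0 -> u = 0) -> is_epi f.
Proof.
move=> H Z g h e; apply/eqP; rewrite -subr_eq0; apply/eqP/H.
by rewrite compmDl compNm e subrr.
Qed.

Lemma epi0 X Y Z (f : Hom X Y) (u : Hom Y Z) : is_epi f -> u ∘ f = 0 -> u = 0.
Proof. by move=> H e; apply: H; rewrite e comp0m. Qed.

Lemma kernel_mono K X Y (k : Hom K X) (f : Hom X Y) : is_kernel k f -> is_mono k.
Proof.
move=> [e H] W g h gh.
have [|t [_ ht]] := H W (k ∘ h); first by rewrite compmA e comp0m.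
by rewrite -(ht g gh) -(ht h erefl).
Qed.

Lemma cokernel_epi X Y Q (q : Hom Y Q) (f : Hom X Y) :
  is_cokernel q f -> is_epi q.
Proof.
move=> [e H] W g h gh.
have [|t [_ ht]] := H W (h ∘ q); first by rewrite -compmA e compm0.
by rewrite -(ht g gh) -(ht h erefl).
Qed.

End PreadditiveFacts.

Section AbelianFacts.
Variable C : abelianCat.
Implicit Types A B X Y Z : C.

Lemma epi_cokernel_kernel K X Y (k : Hom K X) (f : Hom X Y) :
  is_epi f -> is_kernel k f -> is_cokernel f k.
Proof.
move=> ef [fk kP]; split=> // W w wk.
have [M [m [fm mP]]] := epi_is_cokernel ef.
have [t [kt _]] := kP _ _ fm.
by apply: mP; rewrite -kt compmA wk comp0m.
Qed.

Lemma pullback_short_exact A X Y B (i : Hom A X) (p : Hom X Y) (f : Hom B Y) :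
  is_short_exact i p ->
  exists (P : C) (j : Hom A P) (q : Hom P B) (g : Hom P X),
    [/\ is_short_exact j q, g ∘ j = i & is_pullback g q p f].
Proof.
move=> [ik pc]; have ep := cokernel_epi pc; have mi := kernel_mono ik.
have [S [i1 [i2 [p1 [p2 [e11 e22 e12 e21 eS]]]]]] := has_biproducts X B.
pose d := p ∘ p1 - f ∘ p2.
have di1 : d ∘ i1 = p.
  by rewrite /d compmDl compNm -!compmA e11 e21 compm1 compm0 subr0.
have ed : is_epi d.
  apply: epiP => Z u ud; apply: (epi0 ep).
  by rewrite -di1 compmA ud comp0m.
have [P [k kd]] := has_kernels d.
have mk := kernel_mono kd.
have ck := epi_cokernel_kernel ed kd.
have pb : is_pullback (p1 ∘ k) (p2 ∘ k) p f.
  split.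
    apply/eqP; rewrite -subr_eq0 !compmA -compNm -compmDl; apply/eqP.
    by have [+ _] := kd.
  move=> W u v uv.
  have dt : d ∘ (i1 ∘ u + i2 ∘ v) = 0.
    rewrite compmDr !compmA di1 uv /d compmDl compNm -[p ∘ p1 ∘ i2]compmA e12.
    by rewrite compm0 -[f ∘ p2 ∘ i2]compmA e22 compm1 sub0r compNm subrr.
  have [t [kt tu]] := kd.2 _ _ dt.
  exists t; split.
    rewrite -!compmA kt !compmDr !compmA e11 e12 e21 e22.
    by rewrite !comp1m !comp0m addr0 add0r.
  move=> t' [h1 h2]; apply: tu.
  by rewrite -h1 -h2 !compmA -!compmDl eS comp1m.
have eq : is_epi (p2 ∘ k).
  apply: epiP => Z u; rewrite compmA => uk.
  have [w [wd _]] := ck.2 _ _ uk.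
  have w0 : w = 0.
    by apply: (epi0 ep); rewrite -di1 compmA wd -compmA e21 compm0.
  by rewrite -[u]compm1 -e22 compmA -wd w0 !comp0m.
have [pg pbP] := pb.
have [j [[gj qj] _]] : exists! t : Hom A P, p1 ∘ k ∘ t = i /\ p2 ∘ k ∘ t = 0.
  by apply: pbP; rewrite compm0; have [] := ik.
have jk : is_kernel j (p2 ∘ k).
  split=> // W t qt.
  have [s [is_ su]] : exists! s : Hom W A, i ∘ s = p1 ∘ k ∘ t.
    by apply: ik.2; rewrite compmA pg -compmA qt compm0.
  exists s; split.
    have [t0 [_ tu]] : exists! t' : Hom W P,
      p1 ∘ k ∘ t' = i ∘ s /\ p2 ∘ k ∘ t' = 0.
      by apply: pbP; rewrite compm0 compmA ik.1 comp0m.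
    by rewrite -(tu (j ∘ s)) ?(tu t) // !compmA gj qj comp0m.
  by move=> s' js'; apply: su; rewrite -js' compmA gj.
exists P, j, (p2 ∘ k), (p1 ∘ k); split=> //; split=> //.
exact: epi_cokernel_kernel.
Qed.

End AbelianFacts.

Section Ext1.
Variable C : abelianCat.
Implicit Types A B : C.

(* Short exact sequences 0 -> A -> ext_mid -> B -> 0. *)
Record extension B A := Extension {
  ext_mid : C;
  ext_i : Hom A ext_mid;
  ext_p : Hom ext_mid B;
  ext_exact : is_short_exact ext_i ext_p
}.

Definition ext_equiv B A (E F : extension B A) : Prop :=
  exists (g : Hom (ext_mid E) (ext_mid F)) (h : Hom (ext_mid F) (ext_mid E)),
    [/\ h ∘ g = idm _, g ∘ h = idm _,
        g ∘ ext_i E = ext_i F & ext_p F ∘ g = ext_p E].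

Lemma ext_equiv_refl B A (E : extension B A) : ext_equiv E E.
Proof. by exists (idm _), (idm _); rewrite !comp1m !compm1. Qed.

Lemma ext_equiv_sym B A (E F : extension B A) : ext_equiv E F -> ext_equiv F E.
Proof.
move=> [g [h [hg gh gi pg]]]; exists h, g; split=> //.
- by rewrite -gi compmA hg comp1m.
- by rewrite -pg -compmA gh compm1.
Qed.

Lemma ext_equiv_trans B A (E F G : extension B A) :
  ext_equiv E F -> ext_equiv F G -> ext_equiv E G.
Proof.
move=> [g [h [hg gh gi pg]]] [g' [h' [hg' gh' gi' pg']]].
exists (g' ∘ g), (h ∘ h'); split.
- by rewrite -compmA [h' ∘ _]compmA hg' comp1m.
- by rewrite -compmA [g ∘ _]compmA gh comp1m.
- by rewrite -compmA gi.
- by rewrite compmA pg'.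
Qed.

(* Yoneda Ext^1(B, A): the equivalence classes of extensions of B by A. *)
Definition is_ext_class B A (c : set (extension B A)) : Prop :=
  exists E, c = [set F | ext_equiv E F].

Definition Ext1 B A := {c : set (extension B A) | is_ext_class c}.

Lemma is_ext_classP B A (c : set (extension B A)) :
  (exists E, c E) -> (forall E F, c E -> ext_equiv E F -> c F) ->
  (forall E F, c E -> c F -> ext_equiv E F) -> is_ext_class c.
Proof.
move=> [E cE] sat one; exists E; apply/seteqP; split=> F /=; first exact: one.
exact: sat.
Qed.

(* The split extensions: up to the choice of the biproduct,
   0 -> A -> A (+) B -> B -> 0. *)
Definition split_extensions B A : set (extension B A) :=
  [set E | exists (s : Hom B (ext_mid E)) (r : Hom (ext_mid E) A),
     is_biproduct (ext_i E) s r (ext_p E)].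

Lemma split_ext_class B A : is_ext_class (@split_extensions B A).
Proof.
apply: is_ext_classP.
- have [S [i1 [i2 [p1 [p2 bp]]]]] := has_biproducts A B.
  have [e11 e22 e12 e21 eS] := bp.
  have ex : is_short_exact i1 p2.
    split; split=> // W g g0.
    + exists (p1 ∘ g); split; last by move=> h <-; rewrite compmA e11 comp1m.
      by rewrite -[RHS]comp1m -eS compmDl -!compmA g0 compm0 addr0.
    + exists (g ∘ i2); split; last by move=> h <-; rewrite -compmA e22 compm1.
      by rewrite -[RHS]compm1 -eS compmDr !compmA g0 comp0m add0r.
  by exists (Extension ex), i2, p1.
- move=> E F [s [r [e11 e22 e12 e21 eS]]] [g [h [hg gh gi pg]]].
  have hi : h ∘ ext_i F = ext_i E by rewrite -gi compmA hg comp1m.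
  exists (g ∘ s), (r ∘ h); split.
  + by rewrite -compmA hi.
  + by rewrite compmA pg.
  + by rewrite -compmA [h ∘ _]compmA hg comp1m.
  + by rewrite (ext_exact F).1.1.
  + have -> : ext_p F = ext_p E ∘ h by rewrite -pg -compmA gh compm1.
    rewrite -gi -[g ∘ s ∘ _]compmA [s ∘ _]compmA -[g ∘ _ ∘ _]compmA -compmDr.
    by rewrite [ext_i E ∘ _]compmA -compmDl eS comp1m gh.
- move=> E F [s [r [e11 e22 e12 e21 eS]]] [s' [r' [f11 f22 f12 f21 fS]]].
  exists (ext_i F ∘ r + s' ∘ ext_p E), (ext_i E ∘ r' + s ∘ ext_p F); split.
  + rewrite compmDl !compmDr -!compmA [r' ∘ (ext_i F ∘ _)]compmA.
    rewrite [r' ∘ (s' ∘ _)]compmA [ext_p F ∘ (ext_i F ∘ _)]compmA.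
    rewrite [ext_p F ∘ (s' ∘ _)]compmA f11 f12 f21 f22 !comp1m !comp0m !compm0.
    by rewrite addr0 add0r.
  + rewrite compmDl !compmDr -!compmA [r ∘ (ext_i E ∘ _)]compmA.
    rewrite [r ∘ (s ∘ _)]compmA [ext_p E ∘ (ext_i E ∘ _)]compmA.
    rewrite [ext_p E ∘ (s ∘ _)]compmA e11 e12 e21 e22 !comp1m !comp0m !compm0.
    by rewrite addr0 add0r.
  + by rewrite compmDl -!compmA e11 e21 compm1 compm0 addr0.
  + by rewrite compmDr !compmA f21 f22 comp1m comp0m add0r.
Qed.

Definition Ext1_zero B A : Ext1 B A := exist _ _ (split_ext_class B A).

(* For an extension U of D by A and f : B -> D, the extensions E of B by A
   obtained from U by pulling back along f:
     0 -> A -> E -> B -> 0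
          |    |g   |f
     0 -> A -> U -> D -> 0                                          *)
Definition pullback_extensions D A (U : extension D A) B (f : Hom B D) :
    set (extension B A) :=
  [set E | exists g : Hom (ext_mid E) (ext_mid U),
     g ∘ ext_i E = ext_i U /\ is_pullback g (ext_p E) (ext_p U) f].

Lemma pullback_ext_class D A (U : extension D A) B (f : Hom B D) :
  is_ext_class (pullback_extensions U f).
Proof.
apply: is_ext_classP.
- have [P [j [q [g [ex gj pb]]]]] := pullback_short_exact f (ext_exact U).
  by exists (Extension ex), g.
- move=> E F [k [ki [kc kP]]] [g [h [hg gh gi pg]]].
  have ph : ext_p E ∘ h = ext_p F by rewrite -pg -compmA gh compm1.
  exists (k ∘ h); split; first by rewrite -gi -compmA [h ∘ _]compmA hg comp1m.
  split; first by rewrite compmA kc -compmA ph.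
  move=> W u v uv; have [t [[t1 t2] tu]] := kP _ _ _ uv.
  exists (g ∘ t); split.
    by rewrite -compmA [h ∘ _]compmA hg comp1m t1 compmA pg t2.
  move=> t' [t1' t2']; rewrite (tu (h ∘ t')); first by rewrite compmA gh comp1m.
  by rewrite !compmA t1' ph t2'.
- move=> E F [k [ki [kc kP]]] [l [li [lc lP]]].
  have [g [[lg pg] _]] := lP _ _ _ kc.
  have [h [[kh ph] _]] := kP _ _ _ lc.
  exists g, h; split=> //.
  + have [t [_ tu]] := kP _ _ _ kc.
    rewrite -(tu (h ∘ g)); last by rewrite !compmA kh ph.
    by apply: tu; rewrite !compm1.
  + have [t [_ tu]] := lP _ _ _ lc.
    rewrite -(tu (g ∘ h)); last by rewrite !compmA lg pg.
    by apply: tu; rewrite !compm1.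
  + have e : ext_p U ∘ ext_i U = f ∘ (0 : Hom A B).
      by rewrite compm0 (ext_exact U).1.1.
    have [t [_ tu]] := lP _ _ _ e.
    rewrite -(tu (g ∘ ext_i E)).
      by apply: tu; rewrite li (ext_exact F).1.1.
    by rewrite !compmA lg pg ki (ext_exact E).1.1.
Qed.

(* The connecting map Hom B D -> Ext^1(B, A) of U : 0 -> A -> X -> D -> 0. *)
Definition connecting D A (U : extension D A) B (f : Hom B D) : Ext1 B A :=
  exist _ _ (pullback_ext_class U f).

Definition Ext1_eq0 B A : Prop := forall e : Ext1 B A, e = Ext1_zero B A.

Definition rperp1 (V : C) : set C := [set A | Ext1_eq0 V A].

Definition rperp (X : set C) : set C := [set A | forall V, X V -> Ext1_eq0 V A].

Definition lperp (T : set C) : set C := [set A | forall B, T B -> Ext1_eq0 A B].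

Definition ext1_universal (B : C) : Prop :=
  forall A : C, exists (J : smallType) (D : C) (inj : J -> Hom B D)
      (U : extension D A),
    [/\ inhabited J, is_copower inj
      & forall e : Ext1 B A, exists f : Hom B D, connecting U f = e].

Definition epi_generator (G : C) : Prop :=
  forall A : C, exists (I : smallType) (S : C) (inj : I -> Hom G S)
      (q : Hom S A), is_copower inj /\ is_epi q.

Definition preenvelope (T : set C) (M TM : C) (phi : Hom M TM) : Prop :=
  T TM /\
  forall (B : C) (f : Hom M B), T B -> exists g : Hom TM B, g ∘ phi = f.

Definition special_preenvelope (T : set C) (M TM : C) (phi : Hom M TM) : Prop :=
  [/\ preenvelope T phi, is_mono phi
    & exists (Q : C) (q : Hom TM Q), is_cokernel q phi /\ lperp T Q].

Definition special_preenveloping (T : set C) : Prop :=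
  forall M : C, exists (TM : C) (phi : Hom M TM), special_preenvelope T phi.

Definition closed_extensions (T : set C) : Prop :=
  forall (A B : C) (E : extension B A), T A -> T B -> T (ext_mid E).

Definition closed_summands (T : set C) : Prop :=
  forall (A B S : C) (i1 : Hom A S) (i2 : Hom B S) (p1 : Hom S A) (p2 : Hom S B),
    is_biproduct i1 i2 p1 p2 -> T S -> T A.

Definition closed_coproducts (T : set C) : Prop :=
  forall (I : smallType) (F : I -> C) (S : C) (inj : forall i, Hom (F i) S),
    is_coproduct inj -> (forall i, T (F i)) -> T S.

Definition closed_quotients (T : set C) : Prop :=
  forall (A B : C) (q : Hom A B), is_epi q -> T A -> T B.

Definition cotorsion_pair (X Y : set C) : Prop := Y = rperp X /\ X = lperp Y.

Definition right_complete (X Y : set C) : Prop :=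
  forall A : C, exists (B : C) (E : extension B A), Y (ext_mid E) /\ X B.

End Ext1.

(* Main.v *)
(** The first assertion implies the second because the middle term of a
    universal extension of [V] by [M] is killed by [Ext^1(V, -)], and a copower
    of [V] is left orthogonal to whatever [V] is.  The second and third
    are equivalent because an object of [rperp (lperp T)] splits off its special
    [T]-preenvelope.  For the converse of the first implication, let
    [0 -> G -> X -> V -> 0] be a special [T]-preenvelope of an epi-generator.
    Coproducts are not assumed to exist, but any object has as many copowers as
    [G]: it is a cokernel [G^(I1) -> G^(I0)], so its [I]-th copower can be
    computed from [G^(I1 x I)] and [G^(I0 x I)], and these exist together with
    [G^(I0)], [G^(I1)] and [G^(I)] since [|M x M| = |M|] for infinite [M].  If
    [G^(I)] covers [A], pushing out [0 -> G^(I) -> X^(I) -> V^(I) -> 0] along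
    [G^(I) -> A] gives an extension of [V^(I)] by [A] with middle term in [T];
    it is universal, and it splits when [Ext^1(V, A) = 0]. *)

From mathcomp Require Import all_boot all_order all_algebra.
From mathcomp Require Import boolp classical_sets functions cardinality.
Require Import Defs.

Set Implicit Arguments.
Unset Strict Implicit.
Unset Printing Implicit Defensive.

Import GRing.Theory.
Local Open Scope ring_scope.
Local Open Scope classical_set_scope.

(** * Injections between types and squares of infinite types *)

Lemma chain_bigcup2 (T : Type) (F : set (set T)) (u v : T) :
  total_on F subset -> (\bigcup_(X in F) X) u -> (\bigcup_(X in F) X) v ->
  exists X, [/\ F X, X u & X v].
Proof.
move=> tot [X FX Xu] [Y FY Yv].
by have [s|s] := tot _ _ FX FY; [exists Y | exists X]; split=> //; exact: s.
Qed.

(** A maximal partial bijection, given by Zorn's lemma as a relation, is total on one side: if some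
    [a] and some [b] were both unmatched, the pair [(a, b)] could be added. *)
Lemma injection_total (A B : Type) :
  (exists f : A -> B, injective f) \/ (exists f : B -> A, injective f).
Proof.
pose P (R : set (A * B)) := forall u v, R u -> R v -> u.1 = v.1 <-> u.2 = v.2.
have [R [PR maxR]] : exists R, P R /\ forall S, R `<` S -> ~ P S.
  apply: Zorn_bigcup => F FP tot u v Fu Fv.
  by have [X [/FP PX Xu Xv]] := chain_bigcup2 tot Fu Fv; exact: PX.
have full : (forall a, exists b, R (a, b)) \/ (forall b, exists a, R (a, b)).
  apply: contrapT => /not_orP[/existsNP[a Ra] /existsNP[b Rb]].
  apply: (maxR (R `|` [set (a, b)])).
    split; first by move=> u; left.
    by move=> /(_ (a, b) (or_intror erefl)) Rab; apply: Ra; exists b.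
  have cross u : R u -> u.1 <> a /\ u.2 <> b.
    by case: u => x y /= Rxy; split=> e; [apply: Ra; exists y | apply: Rb; exists x];
       rewrite -e.
  move=> u v [Ru|->] [Rv|->] //=; first exact: PR.
    by have [? ?] := cross _ Ru; split.
  by have [? ?] := cross _ Rv; split=> /esym.
case: full => /choice[f fR]; [left | right]; exists f => x y e.
  by apply/(PR _ _ (fR x) (fR y)).
by apply/(PR _ _ (fR x) (fR y)).
Qed.

Lemma nat_injection_or_finite (M : Type) :
  (exists f : nat -> M, injective f) \/
  exists (n : nat) (f : M -> 'I_n), injective f.
Proof.
have [[n]|/infiniteP/card_leP[f]] := pselect (finite_set [set: M]).
  rewrite card_eq_le => /andP[/pcard_leP[f] _]; right.
  have lt x : (f x < n)%N by have : `I_n (f x) by exact: funS.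
  exists n, (fun x => Ordinal (lt x)) => x y [e].
  by apply: (inj (f := f)); rewrite ?in_setT.
left; exists (fun k => val (f (SigSub (mem_set (I : [set: nat] k))))) => k l e.
have [] // : SigSub (mem_set (I : [set: nat] k)) = SigSub (mem_set (I : [set: nat] l)).
by apply: (inj (f := f)); rewrite ?in_setT//; exact: val_inj.
Qed.

(* Zorn's lemma gives a maximal subset [D] of [J] carrying an injection
   [D x D -> D] and containing a countable set, so that several disjoint copies
   of [D] embed in [D].  If [D] embedded in its complement, the injection would
   extend to the union of [D] and its copy; so the complement embeds in [D],
   and then so does [J]. *)
Lemma square_injection (J : Type) (nu : nat -> J) : injective nu ->
  exists q : J * J -> J, injective q.
Proof.
move=> inu.
(* An injection [D x D -> D] is encoded by its graph, a set of triples, so that chains have unions;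
   [dom] recovers [D] from the diagonal. *)
pose dom (R : set (J * J * J)) := [set x | exists y, R (x, x, y)].
pose P R := [/\ forall a b c, R (a, b, c) -> [/\ dom R a, dom R b & dom R c],
  forall a b, dom R a -> dom R b -> exists c, R (a, b, c)
  & forall u v, R u -> R v -> u.1 = v.1 <-> u.2 = v.2].
(* The countable seed: the pairing of [nat] transported along [nu]. *)
pose R0 : set (J * J * J) :=
  [set u | exists m n : nat, u = (nu m, nu n, nu (pickle (m, n)))].
have PR0 : P R0.
  have d m : dom R0 (nu m) by exists (nu (pickle (m, m))), m, m.
  split.
  - by move=> a b c [m [n [-> -> ->]]].
  - move=> a b [_ [m [_ [-> _ _]]]] [_ [n [_ [-> _ _]]]].
    by exists (nu (pickle (m, n))), m, n.
  - move=> _ _ [m [n ->]] [m' [n' ->]] /=.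
    split=> [[/inu-> /inu->] //|/inu /(pcan_inj pickleK) [-> ->] //].
(* Zorn's lemma is applied to the part added to [R0], so that the maximal graph contains [R0] and
   the empty chain needs no separate treatment. *)
have [R1 [PR max]] : exists R, P (R0 `|` R) /\ forall S, R `<` S -> ~ P (R0 `|` S).
  apply: (@Zorn_bigcup _ [set R | P (R0 `|` R)]) => F FP tot /=.
  have dir u v : (R0 `|` \bigcup_(X in F) X) u -> (R0 `|` \bigcup_(X in F) X) v ->
      exists S, [/\ P S, S `<=` R0 `|` \bigcup_(X in F) X, S u & S v].
    have sub X : F X -> R0 `|` X `<=` R0 `|` \bigcup_(X in F) X.
      by move=> FX w [|Xw]; [left | right; exists X].
    move=> [Ru|Fu] [Rv|Fv].
    - by exists R0; split=> // w; left.
    - by have [X FX Xv] := Fv; exists (R0 `|` X); split; [exact: FP | exact: sub | left | right].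
    - by have [X FX Xv] := Fu; exists (R0 `|` X); split; [exact: FP | exact: sub | right | left].
    - have [X [FX Xu Xv]] := chain_bigcup2 tot Fu Fv.
      by exists (R0 `|` X); split; [exact: FP | exact: sub | right | right].
  have domS S U x : S `<=` U -> dom S x -> dom U x.
    by move=> SU [y Sy]; exists y; exact: SU.
  split.
  - move=> a b c Fc; have [S [[PS _ _] SU Sc _]] := dir _ _ Fc Fc.
    by have [? ? ?] := PS _ _ _ Sc; split; apply: domS SU _.
  - move=> a b [a' Fa] [b' Fb]; have [S [[_ PS _] SU Sa Sb]] := dir _ _ Fa Fb.
    by have [||c Sc] := PS a b; [exists a' | exists b' | exists c; exact: SU].
  - by move=> u v Fu Fv; have [S [[_ _ PS] _ Su Sv]] := dir _ _ Fu Fv; exact: PS.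
have : exists R, [/\ P R, R0 `<=` R & forall S, R `<` S -> ~ P S].
  exists (R0 `|` R1); split=> [//|u|S [RS nSR] PS]; first by left.
  apply: (max S).
    split=> [u R1u|SR]; first by apply: RS; right.
    by apply: nSR => u /SR; right.
  by have /setUidPr -> : R0 `<=` S by move=> u R0u; apply: RS; left.
move=> {R1 PR max} [R [PR R0R max]]; have [Pd Pt Pi] := PR.
have domnu m : dom R (nu m).
  by exists (nu (pickle (m, m))); apply: R0R; exists m, m.
have [f fR] : exists f, forall u, dom R u.1 -> dom R u.2 -> R (u, f u).
  suff /choice[f fR] : forall u : J * J, exists c,
      dom R u.1 -> dom R u.2 -> R (u, c) by exists f.
  move=> [a b] /=.
  have [[da db]|nd] := pselect (dom R a /\ dom R b).
    by have [c Rc] := Pt _ _ da db; exists c.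
  by exists a => da db; case: nd.
have fd a b : dom R a -> dom R b -> dom R (f (a, b)).
  by move=> da db; have [] := Pd _ _ _ (fR (a, b) da db).
have fi a b a' b' : dom R a -> dom R b -> dom R a' -> dom R b' ->
    f (a, b) = f (a', b') -> a = a' /\ b = b'.
  move=> da db da' db' e.
  by have /= [_ /(_ e) [-> ->]] := Pi _ _ (fR (a, b) da db) (fR (a', b') da' db').
have sigE (Q : J -> Prop) (x y : {x | Q x}) : sval x = sval y -> x = y.
  by case: x y => [x Qx] [y Qy] /= e; exact: eq_exist.
have [[g ig]|[g ig]] := injection_total {x | dom R x} {x | ~ dom R x}.
  (* [h] parametrizes the union of [D] and its copy, and [w] extends [f] to it. *)
  pose h (b : bool) (x : {x | dom R x}) := if b then sval (g x) else sval x.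
  have ih b b' x x' : h b x = h b' x' -> b = b' /\ x = x'.
    case: b b' => [] [] /= e.
    - by split=> //; apply/ig/sigE.
    - by case: (svalP (g x)); rewrite e; exact: svalP.
    - by case: (svalP (g x')); rewrite -e; exact: svalP.
    - by split=> //; apply: sigE.
  (* Four disjoint copies of [D x D] in [D], tagged by [nu 0] to [nu 3]. The three with a flag set
     receive the blocks of the enlarged square outside [D x D]. *)
  pose v (b b' : bool) (x y : {x | dom R x}) : {x | dom R x} :=
    exist _ _ (fd _ _ (domnu (b + b'.*2)%N) (fd _ _ (svalP x) (svalP y))).
  have iv b1 b2 c1 c2 x1 x2 y1 y2 : v b1 b2 x1 x2 = v c1 c2 y1 y2 ->
      [/\ b1 = c1, b2 = c2, x1 = y1 & x2 = y2].
    move=> [/fi]; case=> [||||/inu eb /fi]; try by [exact: domnu|exact/fd/svalP/svalP].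
    case=> [||||e1 e2]; try exact: svalP.
    by split; try exact: sigE; move: b1 b2 c1 c2 eb => [] [] [] [].
  pose w b1 b2 x1 x2 :=
    if b1 || b2 then sval (g (v b1 b2 x1 x2)) else f (sval x1, sval x2).
  have iw b1 b2 c1 c2 x1 x2 y1 y2 : w b1 b2 x1 x2 = w c1 c2 y1 y2 ->
      [/\ b1 = c1, b2 = c2, x1 = y1 & x2 = y2].
    rewrite /w; case: ifP => b; case: ifP => c e.
    - by apply: iv; apply/ig/sigE.
    - by case: (svalP (g (v b1 b2 x1 x2))); rewrite e; apply: (fd); exact: svalP.
    - by case: (svalP (g (v c1 c2 y1 y2))); rewrite -e; apply: (fd); exact: svalP.
    - move: e => /fi[]; try exact: svalP.
      move=> e1 e2; have [[-> ->] [-> ->]] : (b1 = false /\ b2 = false) /\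
          (c1 = false /\ c2 = false) by move: b1 b2 c1 c2 b c => [] [] [] [].
      by split=> //; exact: sigE.
  pose S : set (J * J * J) := [set u | exists b1 b2 x1 x2,
    u = (h b1 x1, h b2 x2, w b1 b2 x1 x2)].
  have hS b x : dom S (h b x) by exists (w b b x x), b, b, x, x.
  have wS b1 b2 x1 x2 : dom S (w b1 b2 x1 x2).
    rewrite /w; case: ifP => _; first exact: (hS true).
    exact: (hS false (exist _ _ (fd _ _ (svalP x1) (svalP x2)))).
  have RS : R `<=` S.
    move=> [[a b] c] Rc; have [da db _] := Pd _ _ _ Rc.
    exists false, false, (exist _ a da), (exist _ b db); rewrite /h /w /=.
    by have /= [/(_ erefl) ->] := Pi _ _ (fR (a, b) da db) Rc.
  case: (max S).
    (* The extension is strict: [S] contains triples on the copy of [D], which lies outside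
       [dom R]. *)
    split=> // SR; case: (svalP (g (exist _ _ (domnu 0%N)))).
    set x := exist _ _ _.
    have /SR Rx : S (h true x, h true x, w true true x x) by exists true, true, x, x.
    by have [] := Pd _ _ _ Rx.
  split.
  - by move=> a b c [b1 [b2 [x1 [x2 [-> -> ->]]]]].
  - move=> a b [_ [b1 [_ [x1 [_ [-> _ _]]]]]] [_ [b2 [_ [x2 [_ [-> _ _]]]]]].
    by exists (w b1 b2 x1 x2), b1, b2, x1, x2.
  - move=> _ _ [b1 [b2 [x1 [x2 ->]]]] [c1 [c2 [y1 [y2 ->]]]] /=; split.
      by move=> [/ih[-> ->] /ih[-> ->]].
    by move=> /iw[-> -> -> ->].
(* [J] embeds in [D]: the tags [nu 0] and [nu 1] keep the images of [D] and of its complement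
   apart. *)
pose e (x : J) := if pselect (dom R x) is right nx
  then f (nu 1%N, sval (g (exist _ x nx))) else f (nu 0%N, x).
have de x : dom R (e x).
  rewrite /e; case: pselect => dx; apply: fd => //; exact: svalP.
have ie : injective e.
  move=> x y; rewrite /e; case: pselect => dx; case: pselect => dy.
  - by move=> /fi[].
  - by move=> /fi[] //; [exact: svalP | move/inu].
  - by move=> /fi[] //; [exact: svalP | move/inu].
  - move=> /fi[] //; try exact: svalP.
    by move=> _ /sigE/ig/(congr1 sval).
exists (fun u => f (e u.1, e u.2)) => -[a b] [a' b'] /= /fi[] //.
by move=> /ie-> /ie->.
Qed.

(** * The opposite category *)

Definition op_preadditive (C : preadditiveCat) : preadditiveCat :=
  @PreadditiveCat (obj C) (fun X Y => Hom Y X) (@idm C)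
    (fun X Y Z g f => f ∘ g)
    (fun _ _ _ _ h g f => esym (compmA f g h))
    (fun _ _ f => compm1 f) (fun _ _ f => comp1m f)
    (fun _ _ _ g g' f => compmDr f g g') (fun _ _ _ g f f' => compmDl f f' g).

Section Opposite.
Variable C : abelianCat.

Let op_zero : exists Z : op_preadditive C, is_zero_object Z.
Proof. by have [Z zZ] := has_zero_object C; exists Z => X; have [] := zZ X. Qed.

Let op_biproducts (A B : op_preadditive C) : exists (S : op_preadditive C)
  (i1 : Hom A S) (i2 : Hom B S) (p1 : Hom S A) (p2 : Hom S B),
  is_biproduct i1 i2 p1 p2.
Proof.
have [S [i1 [i2 [p1 [p2 [e11 e22 e12 e21 eS]]]]]] := @has_biproducts C A B.
by exists S, p1, p2, i1, i2.
Qed.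

(** Kernels here are convertible to cokernels of [C], and monos to epis, so a fact about abelian
    categories is dualized by mere instantiation. *)
Definition op_abelian : abelianCat :=
  @AbelianCat (op_preadditive C) op_zero op_biproducts
    (fun X Y f => @has_cokernels C Y X f) (fun X Y f => @has_kernels C Y X f)
    (fun X Y f => @epi_is_cokernel C Y X f) (fun X Y f => @mono_is_kernel C Y X f).

End Opposite.

(** * Short exact sequences, pushouts and pullbacks *)

Section ShortExact.
Variable C : abelianCat.
Implicit Types A B D X Y : C.

Lemma pushout_short_exact A A' X B (i : Hom A X) (p : Hom X B) (f : Hom A A') :
  is_short_exact i p ->
  exists (P : C) (j : Hom A' P) (q : Hom P B) (g : Hom X P),
    [/\ is_short_exact j q, q ∘ g = p, g ∘ i = j ∘ f
      & forall W (u : Hom X W) (v : Hom A' W), u ∘ i = v ∘ f ->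
          exists! t : Hom P W, t ∘ g = u /\ t ∘ j = v].
Proof.
move=> [ki ck].
have [P [q [j [g [[kq cj] gq [e U]]]]]] :=
  @pullback_short_exact (op_abelian C) B X A A' p i f (conj ck ki).
by exists P, j, q, g; split.
Qed.

Lemma mono_kernel_cokernel X Y Q (f : Hom X Y) (q : Hom Y Q) :
  is_mono f -> is_cokernel q f -> is_kernel f q.
Proof. exact: (@epi_cokernel_kernel (op_abelian C) Q Y X q f). Qed.

Lemma mono0 W X Y (f : Hom X Y) (u : Hom W X) : is_mono f -> f ∘ u = 0 -> u = 0.
Proof. exact: (@epi0 (op_abelian C) Y X W f u). Qed.

Lemma kernel_lift K X Y (k : Hom K X) (f : Hom X Y) W (g : Hom W X) :
  is_kernel k f -> f ∘ g = 0 -> exists h, k ∘ h = g.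
Proof. by move=> kf /kf.2[h [e _]]; exists h. Qed.

Lemma cokernel_desc X Y Q (q : Hom Y Q) (f : Hom X Y) W (g : Hom Y W) :
  is_cokernel q f -> g ∘ f = 0 -> exists h, h ∘ q = g.
Proof. by move=> cq /cq.2[h [e _]]; exists h. Qed.

Section Split.
Variables (A X B : C) (i : Hom A X) (p : Hom X B).
Hypothesis ex : is_short_exact i p.

Lemma section_retraction (s : Hom B X) : p ∘ s = idm B ->
  exists r : Hom X A, is_biproduct i s r p.
Proof.
move=> ps; have mi := kernel_mono ex.1.
have [r ir] : exists r, i ∘ r = idm X - s ∘ p.
  apply: (kernel_lift ex.1).
  by rewrite compmDr compmN compmA ps comp1m compm1 subrr.
exists r; split=> //; last 1 first.
- by rewrite ir subrK.
- apply: mi; rewrite compmA ir compmDl compNm -compmA ex.1.1 compm0 subr0.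
  by rewrite comp1m compm1.
- by apply: mi; rewrite compmA ir compmDl compNm -compmA ps comp1m !compm1 compm0 subrr.
- exact: ex.1.1.
Qed.

Lemma retraction_section (r : Hom X A) : r ∘ i = idm A ->
  exists s : Hom B X, p ∘ s = idm B.
Proof.
move=> ri; have ep := cokernel_epi ex.2.
have [s sp] : exists s, s ∘ p = idm X - i ∘ r.
  apply: (cokernel_desc ex.2).
  by rewrite compmDl compNm -compmA ri comp1m compm1 subrr.
exists s; apply: ep.
by rewrite -compmA sp compmDr compmN compmA ex.1.1 comp0m compm1 comp1m subr0.
Qed.

End Split.

(** A map out of [P] is determined by its composites with [g] and [j]; the former determines the
    latter because [f] is epic. *)
Lemma pushout_epi A A' X (i : Hom A X) (f : Hom A A') P (j : Hom A' P)
    (g : Hom X P) : is_epi f -> g ∘ i = j ∘ f ->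
  (forall W (u : Hom X W) (v : Hom A' W), u ∘ i = v ∘ f ->
     exists! t : Hom P W, t ∘ g = u /\ t ∘ j = v) -> is_epi g.
Proof.
move=> ef e U W u v uv.
have uvj : u ∘ j = v ∘ j by apply: ef; rewrite -!compmA -e !compmA uv.
have [|t [_ tU]] := U _ (u ∘ g) (u ∘ j); first by rewrite -!compmA e.
by rewrite -(tU u) // -(tU v).
Qed.

(** Recognizes a pullback of extensions from a commutative diagram alone. The maps [g] and [p] are
    jointly monic, since a difference killed by [p] comes from [A], where [g] restricts to the mono
    [j]. *)
Lemma short_exact_pullback A X Y B D (i : Hom A X) (p : Hom X B) (j : Hom A Y)
    (q : Hom Y D) (g : Hom X Y) (f : Hom B D) :
  is_short_exact i p -> is_short_exact j q -> g ∘ i = j -> q ∘ g = f ∘ p ->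
  is_pullback g p q f.
Proof.
move=> ex1 ex2 gi qg; split=> // W u v quv.
have uniq V (t t' : Hom V X) : g ∘ t = g ∘ t' -> p ∘ t = p ∘ t' -> t = t'.
  move=> gt pt; apply/eqP; rewrite -subr_eq0; apply/eqP.
  have [a ia] : exists a, i ∘ a = t - t'.
    by apply: (kernel_lift ex1.1); rewrite compmDr compmN pt subrr.
  rewrite -ia (mono0 (u := a) (kernel_mono ex2.1)) ?compm0 //.
  by rewrite -gi -compmA ia compmDr compmN gt subrr.
(* The map [v] lifts to [X] after passing to the epi [e] onto [W]; the lift is corrected by a map
   into [A] and then descends along [e]. *)
have [P [k [e [h [exP _ [ph _]]]]]] := pullback_short_exact v ex1.
have ee := cokernel_epi exP.2.
have [a ja] : exists a, j ∘ a = g ∘ h - u ∘ e.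
  apply: (kernel_lift ex2.1).
  by rewrite compmDr compmN !compmA qg quv -!compmA ph subrr.
pose w := h - i ∘ a.
have gw : g ∘ w = u ∘ e.
  by rewrite /w compmDr compmN compmA gi ja opprB addrC subrK.
have pw : p ∘ w = v ∘ e.
  by rewrite /w compmDr compmN compmA ex1.1.1 comp0m subr0.
have [t te] : exists t, t ∘ e = w.
  apply: (cokernel_desc exP.2); apply: uniq; rewrite compmA.
    by rewrite gw -compmA exP.1.1 !compm0.
  by rewrite pw -compmA exP.1.1 !compm0.
exists t; split=> [|t' [gt' pt']].
  by split; apply: ee; rewrite -compmA te.
have gt : g ∘ t = u by apply: ee; rewrite -compmA te.
have pt : p ∘ t = v by apply: ee; rewrite -compmA te.
by apply: uniq; rewrite ?gt ?gt' ?pt ?pt'.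
Qed.

End ShortExact.

(** * Vanishing of [Ext^1] and the connecting map *)

Section Ext1Facts.
Variable C : abelianCat.
Implicit Types A B D M V X Y : C.

Lemma split_extensionsE A B (E F : extension B A) :
  split_extensions E -> split_extensions F = ext_equiv E F.
Proof.
move=> sE; have [E' eE'] := split_ext_class B A.
have e : ext_equiv E' E by move: sE; rewrite eE'.
rewrite eE'; apply/propext; split=> h; last exact: ext_equiv_trans h.
exact: ext_equiv_trans (ext_equiv_sym e) h.
Qed.

(** A section turns the sequence into a biproduct, and the split extensions form a single
    equivalence class. This replaces equality of classes by a lifting condition. *)
Lemma Ext1_eq0P A B : Ext1_eq0 B A <->
  forall (X : C) (i : Hom A X) (p : Hom X B), is_short_exact i p ->
    exists s, p ∘ s = idm B.
Proof.
split=> [E0 X i p ex|split0 [c [E cE]]].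
  pose E := Extension ex; pose c := [set F | ext_equiv E F].
  have cE : is_ext_class c by exists E.
  have /(congr1 sval)/= ce := E0 (exist _ c cE).
  have : c E by exact: ext_equiv_refl.
  by rewrite ce => -[s [r [_ ps _ _ _]]]; exists s.
apply: eq_exist; rewrite cE; apply/seteqP.
have sE : split_extensions E.
  have [s ps] := split0 _ _ _ (ext_exact E).
  by have [r bp] := section_retraction (ext_exact E) ps; exists s, r.
by split=> F /=; rewrite (split_extensionsE _ sE).
Qed.

(** The pushout along [f] splits; its retraction composed with [X -> P] extends [f]. *)
Lemma Ext1_extend A X B Y (i : Hom A X) (p : Hom X B) (f : Hom A Y) :
  Ext1_eq0 B Y -> is_short_exact i p -> exists g : Hom X Y, g ∘ i = f.
Proof.
move=> /Ext1_eq0P E0 ex.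
have [P [j [q [g [exP _ gi _]]]]] := pushout_short_exact f ex.
have [s qs] := E0 _ _ _ exP; have [r [rj _ _ _ _]] := section_retraction exP qs.
by exists (r ∘ g); rewrite -compmA gi compmA rj comp1m.
Qed.

Lemma Ext1_lift A X D B (i : Hom A X) (p : Hom X D) (f : Hom B D) :
  Ext1_eq0 B A -> is_short_exact i p -> exists g : Hom B X, p ∘ g = f.
Proof.
move=> /Ext1_eq0P E0 ex.
have [P [j [q [g [exP _ [pg _]]]]]] := pullback_short_exact f ex.
have [s qs] := E0 _ _ _ exP.
by exists (g ∘ s); rewrite compmA pg -compmA qs compm1.
Qed.

(* The last two hypotheses say that [F'] is the pushout of [iF] and [p]. *)
Lemma short_exact_comp A X B F V F' (i : Hom A X) (p : Hom X B)
    (iF : Hom X F) (pF : Hom F V) (j : Hom B F') (q : Hom F' V) (g : Hom F F') :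
  is_short_exact i p -> is_short_exact iF pF -> is_short_exact j q ->
  q ∘ g = pF -> g ∘ iF = j ∘ p ->
  (forall W (u : Hom F W) (v : Hom B W), u ∘ iF = v ∘ p ->
     exists! t : Hom F' W, t ∘ g = u /\ t ∘ j = v) ->
  is_short_exact (iF ∘ i) g.
Proof.
move=> ex exF exj qg gi U.
have eg := pushout_epi (cokernel_epi ex.2) gi U.
have k : is_kernel (iF ∘ i) g.
  split=> [|W w gw]; first by rewrite compmA gi -compmA ex.1.1 compm0.
  have [x ix] : exists x, iF ∘ x = w.
    by apply: (kernel_lift exF.1); rewrite -qg -compmA gw compm0.
  have [a ia] : exists a, i ∘ a = x.
    apply: (kernel_lift ex.1); apply: (mono0 (kernel_mono exj.1)).
    by rewrite compmA -gi -compmA ix.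
  exists a; split=> [|a' e]; first by rewrite -compmA ia.
  apply: (kernel_mono ex.1); apply: (kernel_mono exF.1).
  by rewrite [RHS]compmA e ia ix.
by split=> //; exact: epi_cokernel_kernel.
Qed.

(** An extension [F] of [V] by [X] is pushed out along [p] to one by [B], which splits. Since
    [F -> F'] is epic with kernel [A], the section lifts to [F]. *)
Lemma Ext1_extension V A X B (i : Hom A X) (p : Hom X B) :
  is_short_exact i p -> Ext1_eq0 V A -> Ext1_eq0 V B -> Ext1_eq0 V X.
Proof.
move=> ex EA /Ext1_eq0P EB; apply/Ext1_eq0P => F iF pF exF.
have [F' [j [q [g [exj qg gi U]]]]] := pushout_short_exact p exF.
have [s qs] := EB _ _ _ exj.
have [t gt] := Ext1_lift s EA (short_exact_comp ex exF exj qg gi U).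
by exists t; rewrite -qg -compmA gt.
Qed.

Lemma Ext1_summand V A S (i : Hom A S) (p : Hom S A) :
  p ∘ i = idm A -> Ext1_eq0 V S -> Ext1_eq0 V A.
Proof.
move=> pi ES; apply/Ext1_eq0P => E iE pE ex.
have [g gi] := Ext1_extend i ES ex.
by apply: (retraction_section ex (r := p ∘ g)); rewrite -compmA gi.
Qed.

Lemma Ext1_coproduct (I : smallType) (F : I -> C) (S : C)
    (inj : forall i, Hom (F i) S) A :
  is_coproduct inj -> (forall i, Ext1_eq0 (F i) A) -> Ext1_eq0 S A.
Proof.
move=> cop E0; apply/Ext1_eq0P => X i p ex.
have lift k : {g : Hom (F k) X | p ∘ g = inj k}.
  exact/cid/(Ext1_lift _ (E0 k) ex).
have [s [sg _]] := cop X (fun k => sval (lift k)).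
exists s; have [t [_ tU]] := cop S inj.
rewrite -(tU (p ∘ s)) => [|k]; last by rewrite -compmA sg (svalP (lift k)).
by apply: tU => k; rewrite comp1m.
Qed.

(** Surjectivity of the connecting map becomes a statement about diagrams: every extension maps to
    [U] by a morphism that is the identity on [A]. *)
Lemma connecting_surj B D A (U : extension D A) :
  (forall e : Ext1 B A, exists f : Hom B D, connecting U f = e) <->
  forall E : extension B A, exists (f : Hom B D)
    (g : Hom (ext_mid E) (ext_mid U)),
    g ∘ ext_i E = ext_i U /\ ext_p U ∘ g = f ∘ ext_p E.
Proof.
split=> [surj E|surj [c [E cE]]].
  have cE : is_ext_class [set F | ext_equiv E F] by exists E.
  have [f /(congr1 sval)/= e] := surj (exist _ _ cE).
  have : [set F | ext_equiv E F] E by exact: ext_equiv_refl.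
  by rewrite -e => -[g [gi [pg _]]]; exists f, g.
have [f [g [gi pg]]] := surj E; exists f; apply: eq_exist.
have [E' eE'] := pullback_ext_class U f; rewrite eE' cE.
have : pullback_extensions U f E.
  by exists g; split=> //; exact: short_exact_pullback (ext_exact E) (ext_exact U) gi pg.
rewrite eE' => /= e; apply/seteqP; split=> F h; last exact: ext_equiv_trans h.
exact: ext_equiv_trans (ext_equiv_sym e) h.
Qed.

(** In the long exact sequence the surjective connecting map makes
    [Ext^1(V, M) -> Ext^1(V, ext_mid U)] zero, so the latter group embeds in [Ext^1(V, D) = 0]. The
    proof chases this by hand on an extension [F]. *)
Lemma Ext1_universal_extension V M D (U : extension D M) :
  (forall e : Ext1 V M, exists f : Hom V D, connecting U f = e) ->
  Ext1_eq0 V D -> Ext1_eq0 V (ext_mid U).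
Proof.
move=> /connecting_surj surj /Ext1_eq0P ED; apply/Ext1_eq0P => F iF pF exF.
have [F' [j [q [g [exj qg gi Uq]]]]] := pushout_short_exact (ext_p U) exF.
have [s qs] := ED _ _ _ exj.
have exM := short_exact_comp (ext_exact U) exF exj qg gi Uq.
(* The obstruction to lifting [s] to [F] is an extension [N] of [V] by [M]. It maps to [U] by some
   [h], and [n - iF ∘ h] vanishes on [M], so it descends to the lift. *)
have [N [iN [pN [n [exN ni [gn _]]]]]] := pullback_short_exact s exM.
have [f [h [hi _]]] := surj (Extension exN).
have [t tp] : exists t, t ∘ pN = n - iF ∘ h.
  apply: (cokernel_desc exN.2).
  by rewrite compmDl compNm ni -compmA hi subrr.
exists t; apply: (cokernel_epi exN.2).
rewrite -compmA tp compmDr compmN compmA exF.1.1 comp0m subr0.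
by rewrite -qg -compmA gn compmA qs.
Qed.

End Ext1Facts.

(** * Existence of copowers *)

Section Copowers.
Variable C : abelianCat.
Implicit Types (B D Q X Y : C) (I J : smallType).

Lemma coproduct_desc I (F : I -> C) (S : C) (inj : forall i, Hom (F i) S) Y
    (g : forall i, Hom (F i) Y) :
  is_coproduct inj -> exists h, forall i, h ∘ inj i = g i.
Proof. by move=> /(_ Y g)[h [e _]]; exists h. Qed.

Lemma coproduct_uniq I (F : I -> C) (S : C) (inj : forall i, Hom (F i) S) Y
    (u v : Hom S Y) :
  is_coproduct inj -> (forall i, u ∘ inj i = v ∘ inj i) -> u = v.
Proof.
move=> cop uv; have [t [_ tU]] := cop Y (fun i => u ∘ inj i).
by rewrite -(tU u) // -(tU v).
Qed.

Definition has_copower B I := exists (S : C) (inj : I -> Hom B S), is_copower inj.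

(** Colimits commute with colimits; only the copowers of [X] and [Y] have to be given, that of [Q]
    is constructed. *)
Lemma copower_cokernel I X Y Q SX SY D (f : Hom X Y) (q : Hom Y Q)
    (a : I -> Hom X SX) (b : I -> Hom Y SY) (Sf : Hom SX SY) (c : Hom SY D) :
  is_cokernel q f -> is_copower a -> is_copower b ->
  (forall i, Sf ∘ a i = b i ∘ f) -> is_cokernel c Sf ->
  exists v : I -> Hom Q D, is_copower v.
Proof.
move=> cq ca cb Sfa cc.
have v i : {v : Hom Q D | v ∘ q = c ∘ b i}.
  apply/cid/(cokernel_desc cq).
  by rewrite -compmA -Sfa compmA cc.1 comp0m.
exists (fun i => sval (v i)) => Z g.
have [h hb] := coproduct_desc (fun i => g i ∘ q) cb.
have [t tc] : exists t, t ∘ c = h.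
  apply: (cokernel_desc cc); apply: (coproduct_uniq ca) => i.
  by rewrite -compmA Sfa compmA hb -compmA cq.1 compm0 comp0m.
have tv i : t ∘ sval (v i) = g i.
  apply: (cokernel_epi cq).
  by rewrite -compmA (svalP (v i)) compmA tc hb.
exists t; split=> // t' t'v; apply: (cokernel_epi cc); apply: (coproduct_uniq cb) => i.
by rewrite -!compmA -(svalP (v i)) !compmA tv t'v.
Qed.

Lemma has_copower_sub B I J (f : J -> I) :
  injective f -> has_copower B I -> has_copower B J.
Proof.
move=> inf [S [inj cop]].
have [k [kf fk]] : exists k : I -> option J,
    (forall j, k (f j) = Some j) /\ (forall i j, k i = Some j -> f j = i).
  suff /choice[k kP] : forall i, exists o : option J,
      (forall j, f j = i <-> o = Some j).
    by exists k; split=> [j|i j]; [apply/(kP (f j)) | move/kP].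
  move=> i; have [[j fj]|nf] := pselect (exists j, f j = i).
    by exists (Some j) => j'; rewrite -fj; split=> [/inf ->|[->]].
  by exists None => j; split=> // fj; case: nf; exists j.
have [e einj] := coproduct_desc
  (fun i => if k i is Some j then inj (f j) else 0) cop.
(* The idempotent [e] kills the summands outside the image of [f]; splitting it off by this cokernel
   leaves [B^(J)]. *)
have [D [q cq]] := has_cokernels (idm S - e).
have qe : q ∘ e = q.
  apply/esym/eqP; rewrite -subr_eq0 -{1}[q]compm1 -compmN -compmDr; exact/eqP/cq.1.
exists D, (fun j => q ∘ inj (f j)) => Y g.
have [h hinj] := coproduct_desc
  (fun i => if k i is Some j then g j else 0) cop.
have [t tq] : exists t, t ∘ q = h.
  apply: (cokernel_desc cq); apply: (coproduct_uniq cop) => i.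
  rewrite compmDr compmN compm1 compmDl compNm -compmA einj hinj comp0m.
  by case: (k i) => [j|]; rewrite ?compm0 ?subrr // hinj kf subrr.
exists t; split=> [j|t' t'q]; first by rewrite compmA tq hinj kf.
apply: (cokernel_epi cq); apply: (coproduct_uniq cop) => i.
rewrite tq hinj -qe compmA -compmA einj.
by case: (k i) => [j|]; rewrite ?compm0 // -compmA t'q.
Qed.

Lemma has_copower_sum B I J :
  has_copower B I -> has_copower B J -> has_copower B (I + J)%type.
Proof.
move=> [S [a ca]] [S' [b cb]].
have [D [i1 [i2 [p1 [p2 [e11 e22 e12 e21 eD]]]]]] := has_biproducts S S'.
exists D, (fun u => match u with inl i => i1 ∘ a i | inr j => i2 ∘ b j end) => Y g.
have [h ha] := coproduct_desc (fun i => g (inl i)) ca.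
have [k kb] := coproduct_desc (fun j => g (inr j)) cb.
exists (h ∘ p1 + k ∘ p2); split=> [[i|j]|t tg].
- rewrite compmDl !compmA -[h ∘ p1 ∘ i1]compmA -[k ∘ p2 ∘ i1]compmA e11 e21.
  by rewrite compm1 compm0 comp0m addr0 ha.
- rewrite compmDl !compmA -[h ∘ p1 ∘ i2]compmA -[k ∘ p2 ∘ i2]compmA e12 e22.
  by rewrite compm1 compm0 comp0m add0r kb.
- have -> : h = t ∘ i1.
    by apply: (coproduct_uniq ca) => i; rewrite ha -compmA (tg (inl i)).
  have -> : k = t ∘ i2.
    by apply: (coproduct_uniq cb) => j; rewrite kb -compmA (tg (inr j)).
  by rewrite -!compmA -compmDr eD compm1.
Qed.

Lemma has_copower_empty B I : ~ inhabited I -> has_copower B I.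
Proof.
move=> nI; have [Z zZ] := has_zero_object C.
exists Z, (fun=> 0) => Y g; exists 0; split=> [i|h _]; first by case: nI.
exact/esym/(zZ Y).2.
Qed.

Lemma has_copower_unit B : has_copower B unit.
Proof.
exists B, (fun=> idm B) => Y g; exists (g tt); split=> [[]|h hg].
  by rewrite compm1.
by rewrite -(hg tt) compm1.
Qed.

Lemma has_copower_ord B n : has_copower B 'I_n.
Proof.
elim: n => [|n IHn]; first by apply: has_copower_empty => -[[]].
pose f (i : 'I_n.+1) : 'I_n + unit := if unlift ord0 i is Some j then inl j else inr tt.
apply: (has_copower_sub (f := f)) (has_copower_sum IHn (has_copower_unit B)).
by move=> i j; rewrite /f; case: unliftP => [i' ->|->]; case: unliftP => [j' ->|->] // [->].
Qed.

(* [B^(I x J)] embeds into [B^(M x M)] for [M = I + J], and [M x M] is finite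
   or of the cardinality of [M]. *)
Lemma has_copower_prod B I J :
  has_copower B I -> has_copower B J -> has_copower B (I * J)%type.
Proof.
move=> hI hJ; have hM := has_copower_sum hI hJ.
pose f (u : I * J) : (I + J) * (I + J) := (inl u.1, inr u.2).
apply: (has_copower_sub (f := f)) => [[i j] [i' j'] [-> ->] //|].
have [[nu inu]|[n [g ig]]] := nat_injection_or_finite (I + J)%type.
  by have [q iq] := square_injection inu; exact: has_copower_sub iq hM.
pose h (u : (I + J) * (I + J)) := enum_rank (g u.1, g u.2).
apply: (has_copower_sub (f := h)) (has_copower_ord B _).
by move=> [a b] [a' b'] /enum_rank_inj [/ig -> /ig ->].
Qed.

Lemma copower_copower B I J S T (a : I -> Hom B S) (b : J * I -> Hom B T) :
  is_copower a -> is_copower b -> exists c : J -> Hom S T,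
    is_copower c /\ forall j i, c j ∘ a i = b (j, i).
Proof.
move=> ca cb.
have c j : {c : Hom S T | forall i, c ∘ a i = b (j, i)}.
  exact/cid/(coproduct_desc (fun i => b (j, i)) ca).
exists (fun j => sval (c j)); split=> [Y g|j]; last exact: svalP (c j).
have [h hb] := coproduct_desc (fun u => g u.1 ∘ a u.2) cb.
exists h; split=> [j|h' h'c].
  by apply: (coproduct_uniq ca) => i; rewrite -compmA (svalP (c j)) hb.
apply: (coproduct_uniq cb) => -[j i].
by rewrite hb -(svalP (c j)) compmA h'c.
Qed.

Lemma has_copower_copower B I J S (a : I -> Hom B S) :
  is_copower a -> has_copower B J -> has_copower S J.
Proof.
move=> ca hJ; have [|T [b cb]] := has_copower_prod hJ (J := I); first by exists S, a.
by have [c [cc _]] := copower_copower ca cb; exists T, c.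
Qed.

Lemma copower_map I X Y SX SY (f : Hom X Y) (a : I -> Hom X SX)
    (b : I -> Hom Y SY) :
  is_copower a -> exists Sf : Hom SX SY, forall i, Sf ∘ a i = b i ∘ f.
Proof. exact: (coproduct_desc (fun i => b i ∘ f)). Qed.

Lemma has_copower_cokernel I X Y Q (f : Hom X Y) (q : Hom Y Q) :
  is_cokernel q f -> has_copower X I -> has_copower Y I -> has_copower Q I.
Proof.
move=> cq [SX [a ca]] [SY [b cb]]; have [Sf Sfa] := copower_map f b ca.
have [D [c cc]] := has_cokernels Sf.
by have [v cv] := copower_cokernel cq ca cb Sfa cc; exists D, v.
Qed.

Lemma cokernel_comp_epi W X Y Q (e : Hom W X) (f : Hom X Y) (q : Hom Y Q) :
  is_cokernel q f -> is_epi e -> is_cokernel q (f ∘ e).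
Proof.
move=> cq ee; split=> [|Z g]; first by rewrite compmA cq.1 comp0m.
by rewrite compmA => /(epi0 ee); exact: cq.2.
Qed.

(** Covering [A] and then the kernel of the cover presents [A] as a cokernel of copowers of [G],
    whose own [I]-th copowers are copowers of [G] over product index sets. *)
Lemma epi_generator_copower G A I :
  epi_generator G -> has_copower G I -> has_copower A I.
Proof.
move=> gen hI; have [I0 [S0 [a0 [q0 [c0 e0]]]]] := gen A.
have [N [k kk]] := has_kernels q0.
have [I1 [S1 [a1 [q1 [c1 e1]]]]] := gen N.
apply: (has_copower_cokernel (cokernel_comp_epi (epi_cokernel_kernel e0 kk) e1)).
  exact: has_copower_copower c1 hI.
exact: has_copower_copower c0 hI.
Qed.

Lemma epi_generator_inhabited G A : epi_generator G ->
  exists (I : smallType) (S : C) (inj : I -> Hom G S) (q : Hom S A),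
    [/\ inhabited I, is_copower inj & is_epi q].
Proof.
move=> gen; have [I [S [inj [q [cop eq]]]]] := gen A.
have [iI|nI] := pselect (inhabited I); first by exists I, S, inj, q.
have [S1 [inj1 c1]] := has_copower_unit G.
(* An empty copower is zero, so [A] is zero and the zero map [G -> A] is epic. Universal extensions
   require a non-empty index set. *)
exists unit, S1, inj1, 0; split=> // Z g h _; apply: eq.
by apply: (coproduct_uniq cop) => i; case: nI.
Qed.

End Copowers.

(** * Special preenvelopes and orthogonal classes *)

Section SpecialPreenvelopes.
Variable C : abelianCat.
Implicit Types (T : set C) (A B M Q V X : C).

Lemma rperp1E V : rperp1 V = rperp [set V].
Proof. by apply/seteqP; split=> A h; [move=> _ -> | exact: h]. Qed.

Lemma closed_extensions_rperp (X : set C) : closed_extensions (rperp X).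
Proof.
move=> A B E hA hB V XV; apply: (Ext1_extension (ext_exact E)); [exact: hA | exact: hB].
Qed.

Lemma closed_summands_rperp (X : set C) : closed_summands (rperp X).
Proof.
by move=> A B S i1 i2 p1 p2 [e11 _ _ _ _] hS V XV; apply: (Ext1_summand e11 (hS V XV)).
Qed.

Lemma short_exact_special_preenvelope T M X Q (i : Hom M X) (p : Hom X Q) :
  is_short_exact i p -> T X -> lperp T Q -> special_preenvelope T i.
Proof.
move=> ex TX pQ; split; last by exists Q, p; split=> //; exact: ex.2.
  by split=> // B f TB; apply: (Ext1_extend f (pQ B TB) ex).
exact: kernel_mono ex.1.
Qed.

Lemma special_preenvelope_short_exact T M X (i : Hom M X) :
  special_preenvelope T i ->
  exists (Q : C) (p : Hom X Q), is_short_exact i p /\ lperp T Q.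
Proof.
move=> [_ mi [Q [p [cp pQ]]]]; exists Q, p; split=> //; split=> //.
exact: mono_kernel_cokernel.
Qed.

Lemma special_preenveloping_right_complete T :
  special_preenveloping T <-> right_complete (lperp T) T.
Proof.
split=> h M.
  have [X [i sp]] := h M; have [Q [p [ex pQ]]] := special_preenvelope_short_exact sp.
  by have [[TX _] _ _] := sp; exists Q, (Extension ex).
have [Q [E [TE pQ]]] := h M; exists (ext_mid E), (ext_i E).
exact: short_exact_special_preenvelope (ext_exact E) TE pQ.
Qed.

Lemma rperp_lperp T : special_preenveloping T -> closed_summands T ->
  T = rperp (lperp T).
Proof.
move=> sp cs; apply/seteqP; split=> A hA; first by move=> V pV; exact: pV.
have [X [i spi]] := sp A; have [[TX _] _ _] := spi.
have [Q [p [ex pQ]]] := special_preenvelope_short_exact spi.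
have /Ext1_eq0P/(_ _ _ _ ex)[s ps] := hA Q pQ.
have [r bp] := section_retraction ex ps.
exact: cs bp TX.
Qed.

Lemma special_preenveloping_rperp1 V : ext1_universal V ->
  (forall (I : smallType) (S : C) (inj : I -> Hom V S),
     is_copower inj -> rperp1 V S) ->
  special_preenveloping (rperp1 V).
Proof.
move=> univ cV M; have [J [D [inj [U [_ cop surj]]]]] := univ M.
exists (ext_mid U), (ext_i U); apply: short_exact_special_preenvelope (ext_exact U) _ _.
  exact: Ext1_universal_extension surj (cV _ _ _ cop).
by move=> B VB; apply: (Ext1_coproduct cop).
Qed.

(** * Universal extensions from an epi-generator *)

Section EpiGenerator.
Variables (T : set C) (G X V : C) (i : Hom G X) (p : Hom X V).
Hypotheses (gen : epi_generator G) (sp : special_preenveloping T).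
Hypotheses (cc : closed_coproducts T) (cq : closed_quotients T).
Hypotheses (ex : is_short_exact i p) (TX : T X) (pV : lperp T V).

(* The map [G^(I) -> X^(I)] is monic, because every special [T]-preenvelope of
   [G^(I)] factors through it; its cokernel is [V^(I)].  The pushout of the
   resulting extension along an epimorphism [G^(I) -> A] is the one wanted. *)
Lemma copower_extension A : exists (I : smallType) (D : C) (v : I -> Hom V D)
    (U : extension D A), [/\ inhabited I, is_copower v & T (ext_mid U)].
Proof.
have [I [Z [a [q [iI ca eq]]]]] := epi_generator_inhabited A gen.
have [|Y [b cb]] := epi_generator_copower X gen (I := I); first by exists Z, a.
have [f fa] := copower_map i b ca.
have mf : is_mono f.
  have [TZ [z [[TTZ _] mz _]]] := sp Z.
  have g k : {g : Hom X TZ | g ∘ i = z ∘ a k}.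
    exact/cid/(Ext1_extend _ (pV TTZ) ex).
  have [h hb] := coproduct_desc (fun k => sval (g k)) cb.
  have hf : h ∘ f = z.
    by apply: (coproduct_uniq ca) => k; rewrite -compmA fa compmA hb (svalP (g k)).
  by move=> W u w uw; apply: mz; rewrite -hf -!compmA uw.
have [D [c ck]] := has_cokernels f.
have [v cv] := copower_cokernel ex.2 ca cb fa ck.
have [P [j [r [g [exP _ gf U]]]]] :=
  pushout_short_exact q (conj (mono_kernel_cokernel mf ck) ck).
exists I, D, v, (Extension exP); split=> //=.
apply: (cq (pushout_epi eq gf U)); apply: (cc cb) => _; exact: TX.
Qed.

(** As [V] is left orthogonal to the middle term of [U], the inclusion of [A] into it extends over
    any extension of [V] by [A]; the map induced on cokernels is the required [f]. *)
Lemma copower_extension_universal : ext1_universal V.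
Proof.
move=> A; have [I [D [v [U [iI cv TU]]]]] := copower_extension A.
exists I, D, v, U; split=> //; apply/connecting_surj => E.
have [g gi] := Ext1_extend (ext_i U) (pV TU) (ext_exact E).
have [f fp] : exists f, f ∘ ext_p E = ext_p U ∘ g.
  apply: (cokernel_desc (ext_exact E).2).
  by rewrite -compmA gi (ext_exact U).1.1.
by exists f, g.
Qed.

Lemma rperp1_epi_generator : closed_summands T -> T = rperp1 V.
Proof.
move=> cs; apply/seteqP; split=> A hA; first exact: pV.
have [I [D [v [U [_ cv TU]]]]] := copower_extension A.
have /Ext1_eq0P/(_ _ _ _ (ext_exact U))[s ps] : Ext1_eq0 D A.
  exact: Ext1_coproduct cv (fun=> hA).
have [r bp] := section_retraction (ext_exact U) ps.
exact: cs bp TU.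
Qed.

End EpiGenerator.

End SpecialPreenvelopes.

(** * Implications between the three assertions *)

Theorem corollary4p16 (C : abelianCat) (T : set C) :
  let assertion1 :=
    exists V : C,
      [/\ T = rperp1 V,
          ext1_universal V
        & forall (I : smallType) (S : C) (inj : I -> Hom V S),
            is_copower inj -> rperp1 V S] in
  let assertion2 :=
    [/\ special_preenveloping T, closed_extensions T & closed_summands T] in
  let assertion3 :=
    cotorsion_pair (lperp T) T /\ right_complete (lperp T) T in
  [/\ assertion1 -> assertion2,
      assertion2 <-> assertion3
    & (exists G : C, epi_generator G) ->
      closed_coproducts T -> closed_quotients T ->
      (assertion1 <-> assertion2) /\ (assertion2 <-> assertion3)].
Proof.
move=> assertion1 assertion2 assertion3.
have h12 : assertion1 -> assertion2.
  rewrite /assertion2 => -[V [-> univ cV]]; split; first exact: special_preenveloping_rperp1.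
    by rewrite rperp1E; exact: closed_extensions_rperp.
  by rewrite rperp1E; exact: closed_summands_rperp.
have h23 : assertion2 <-> assertion3.
  split=> [[sp _ cs]|[[eT _] rc]].
    by split; [split=> //; exact: rperp_lperp | exact/special_preenveloping_right_complete].
  (* Both closure properties hold for any right orthogonal class, and the cotorsion pair makes [T]
     one. *)
  split; first exact/special_preenveloping_right_complete.
    by rewrite eT; exact: closed_extensions_rperp.
  by rewrite eT; exact: closed_summands_rperp.
split=> // -[G gen] cc cq; split=> //; split=> // -[sp _ cs].
have [X [i spi]] := sp G; have [[TX _] _ _] := spi.
have [V [p [ex pV]]] := special_preenvelope_short_exact spi.
have eT := rperp1_epi_generator gen sp cc cq ex TX pV cs.
exists V; split=> //; first exact: copower_extension_universal gen sp cc cq ex TX pV.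
(* [V] is a quotient of [X], hence lies in [T], and so do its copowers. *)
move=> I S inj cop; rewrite -eT; apply: (cc _ _ _ _ cop) => _.
exact: cq (cokernel_epi ex.2) TX.
Qed.
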